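(* Let $\mathcal{H}=\{rrr,bbr,yyr\}$. Then $h_2(n,\mathcal{H})=\lceil n/2\rceil$.
   Context: Here $n$ denotes the number of vertices of the complete graph $K_n$. Edge-colorings of $K_n$ use colors from $\{r,b,y\}$ (red, blue, yellow); they need not be proper, and not all colors need be used. A pattern is an edge-colored triangle, denoted by the multiset of the colors of its three edges; e.g. $rrr$ is the all-red triangle, $bbr$ is the triangle with two blue edges and one red edge, and $yyr$ has two yellow edges and one red edge. For a family $\mathcal{H}$ of patterns, $\operatorname{Forb}(n,\mathcal{H})$ is the set of all edge-colorings of $K_n$ with colors from $\{r,b,y\}$ in which no triangle has a coloring belonging to $\mathcal{H}$. For an edge-coloring $c$ of $K_n$, $h_2(c)$ is the maximum $k$ such that there is a set of $k$ vertices whose induced edges use at most two of the three colors. Finally, $h_2(n,\mathcal{H})=\min\{h_2(c): c\in\operatorname{Forb}(n,\mathcal{H})\}$.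
   Formalization: The case n = 2 is excluded, because the single edge of K_2 uses only one color, so h_2(2,H) = 2 while ⌈2/2⌉ = 1; all other n are covered. *)

(* Defs.v *)
From HB Require Import structures.
From mathcomp Require Import all_boot.

Set Implicit Arguments.
Unset Strict Implicit.
Unset Printing Implicit Defensive.

Inductive color := red | blue | yellow.

Definition ord_of_color (a : color) : 'I_3 :=
  match a with red => inord 0 | blue => inord 1 | yellow => inord 2 end.

Definition color_of_ord (i : 'I_3) : color :=
  match val i with 0 => red | 1 => blue | _ => yellow end.

Lemma ord_of_colorK : cancel ord_of_color color_of_ord.
Proof. by case; rewrite /color_of_ord /= inordK. Qed.

HB.instance Definition _ := Countable.copy color (can_type ord_of_colorK).
HB.instance Definition _ : isFinite color := CanIsFinite ord_of_colorK.

Definition edge (n : nat) := {e : {set 'I_n} | #|e| == 2}.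

Definition coloring (n : nat) := {ffun edge n -> color}.

(* A pattern is a multiset of colors, i.e. a sequence up to perm_eq. *)
Definition pattern := seq color.

Definition induced_colors (n : nat) (c : coloring n) (S : {set 'I_n}) :
    seq color :=
  [seq c e | e : edge n in [pred e : edge n | val e \subset S]].

Definition Forb (n : nat) (H : seq pattern) : {set coloring n} :=
  [set c : coloring n | [forall T : {set 'I_n}, (#|T| == 3) ==>
     ~~ has (fun p : pattern => perm_eq (induced_colors c T) p) H]].

Definition at_most_two_colored (n : nat) (c : coloring n) (S : {set 'I_n}) :
    bool :=
  #|[set a in induced_colors c S]| <= 2.

Definition h2 (n : nat) (c : coloring n) : nat :=
  \max_(S : {set 'I_n} | at_most_two_colored c S) #|S|.

(* Since h2 c <= n, the default value n does not affect the minimum unless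
   Forb n H is empty; see h2_minP. *)
Definition h2_min (n : nat) (H : seq pattern) : nat :=
  \big[minn/n]_(c in Forb n H) h2 c.

Lemma h2_le (n : nat) (c : coloring n) : h2 c <= n.
Proof.
by apply/bigmax_leqP => S _; rewrite -[leqRHS]card_ord max_card.
Qed.

Lemma h2_minP (n : nat) (H : seq pattern) : Forb n H != set0 ->
  (exists2 c, c \in Forb n H & h2 c = h2_min n H) /\
  (forall c, c \in Forb n H -> h2_min n H <= h2 c).
Proof.
case/set0Pn => c0 c0F.
have lb c : c \in Forb n H -> h2_min n H <= h2 c.
  move=> cF; rewrite /h2_min; have := mem_index_enum c.
  elim: (index_enum _) => //= d r IHr; rewrite inE big_cons.
  case/predU1P=> [<-|/IHr le_r]; first by rewrite cF geq_minl.
  by case: ifP => // _; rewrite geq_min le_r orbT.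
split=> //.
case: (arg_minnP (@h2 n) c0F) => c cF cmin.
exists c => //; apply/eqP; rewrite eqn_leq lb // andbT /h2_min.
by elim/big_ind: _ => [|x y hx hy|d dF]; rewrite ?h2_le ?leq_min ?hx ?cmin.
Qed.

Definition patterns_rrr_bbr_yyr : seq pattern :=
  [:: [:: red; red; red]; [:: blue; blue; red]; [:: yellow; yellow; red]].

(* Main.v *)
Require Import Defs.
From mathcomp Require Import all_boot.
From mathcomp Require Import zify.

(* Lower bound: the red graph is bipartite, so one of its parts has at least
   n/2 vertices and spans no red edge. Otherwise take a shortest odd red closed
   walk x_0, ..., x_{L-1}; it is chordless and L >= 5. A triangle with exactly
   one red edge has a blue and a yellow one, so the color of x_i x_{i+d}
   alternates for d = 2, ..., L-2. Hence x_{i-2} x_i and x_i x_{i+2} have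
   different colors for all i, impossible since L is odd.

   Upper bound: split the vertices into two parts of almost equal size, color
   the edges inside the parts blue, those of a (near-)perfect matching between
   the parts red, and all others yellow. The yellow edges also contain a
   (near-)perfect matching, so a set missing red or yellow has at most one
   vertex in each matching pair, while a set missing blue has at most one
   vertex in each part. *)

Set Implicit Arguments.
Unset Strict Implicit.
Unset Printing Implicit Defensive.

(** * Bipartite graphs and odd closed walks *)

Section Bipartite.
Variables (T : finType) (e : rel T).
Hypothesis e_sym : symmetric e.

(** Only [z 0, ..., z m] matter; with the closing edge the walk has [m.+1] edges. *)
Definition odd_walk_free := forall (m : nat) (z : nat -> T),
  (forall k, k < m -> e (z k) (z k.+1)) -> e (z m) (z 0) -> ~~ odd m.+1.

Definition double_cover : rel (T * bool) :=
  fun u v => e u.1 v.1 && (v.2 == ~~ u.2).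

Lemma double_cover_connect_sym : connect_sym double_cover.
Proof.
apply: sym_connect_sym => -[x a] [y b].
by rewrite /double_cover /= e_sym; case: a; case: b.
Qed.

Lemma double_cover_path p x a : path double_cover (x, a) p ->
  path e x (map fst p) /\ (last (x, a) p).2 = a (+) odd (size p).
Proof.
elim: p x a => [|[y b] p IHp] x a /=; first by rewrite addbF.
case/andP=> /andP[/= exy /eqP->] /IHp[yp ->]; rewrite exy yp; split=> //.
by case: a; case: (odd _).
Qed.

Lemma double_cover_lift p x a : path e x p ->
  connect double_cover (x, a) (last x p, a (+) odd (size p)).
Proof.
elim: p x a => [|y p IHp] x a /=; first by rewrite addbF connect0.
case/andP=> exy /(IHp _ (~~ a)) yp.
have -> : a (+) ~~ odd (size p) = ~~ a (+) odd (size p) by case: (a); case: odd.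
by apply: connect_trans yp; apply: connect1; rewrite /double_cover /= exy eqxx.
Qed.

(** Each step switches sheets, so a path between the two copies of [x] projects to a closed walk of
    odd length. *)
Lemma double_cover_sheets : odd_walk_free ->
  forall x a, ~~ connect double_cover (x, a) (x, ~~ a).
Proof.
move=> owf x a; apply/negP => /connectP[p /double_cover_path[]].
set q := map fst p => xq /[swap] lastp; rewrite -lastp /= => odd_p.
have {odd_p} odd_q : odd (size q).
  by rewrite size_map; case: (a) odd_p; case: odd.
have {lastp} lastq : last x q = x.
  by rewrite -[x in LHS]/((x, a).1) last_map -lastp.
have q_gt0 : 0 < size q by case: (size q) odd_q.
have /pathP := xq => /(_ x) qE.
have := owf (size q).-1 (nth x (x :: q)); rewrite prednK // odd_q.
suff nil_walk : e (nth x (x :: q) (size q).-1) x.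
  by move=> H; suff: false by []; apply: H => // k kq; apply: qE; lia.
by rewrite -[x in X in e _ X]lastq -nth_last; apply: qE; lia.
Qed.

(** The part of [x] records whether the root of its component, on sheet [true], reaches [(x, true)].
    If it does for both ends of an edge, the two copies of [y] are connected. If it does not for
    [x], the lift of a path from the root to [x] ends in [(x, false)], one step from [(y, true)]. *)
Lemma odd_walk_free_bipartite : odd_walk_free ->
  exists s : T -> bool, forall x y, e x y -> s x != s y.
Proof.
move=> owf; have esc := sym_connect_sym e_sym.
have dsc := double_cover_connect_sym.
exists (fun x => connect double_cover (root e x, true) (x, true)) => x y exy.
have step a : connect double_cover (x, a) (y, ~~ a).
  by apply: connect1; rewrite /double_cover /= exy eqxx.
have -> : root e y = root e x by apply/(rootP esc); rewrite esc connect1.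
set r := root e x.
have rx : connect e r x by rewrite esc connect_root.
case rxt : (connect _ (r, true) (x, true)).
  rewrite eq_sym eqb_id.
  apply/negP => ryt; apply/negP: (double_cover_sheets owf y true); rewrite negbK.
  rewrite dsc in ryt; apply: connect_trans ryt (connect_trans rxt _); exact: step.
case/connectP: rx => p rp xE; have := double_cover_lift true rp.
rewrite -xE; case: (true (+) _) => [|/connect_trans->//]; first by rewrite rxt.
Qed.

End Bipartite.

(** To be used with [e] red and [f] blue. The last two hypotheses express the absence of rrr, and of
    bbr and yyr. Strong induction on [m] replaces the choice of a shortest walk. *)
Lemma no_odd_walk (T : finType) (e f : rel T) :
    symmetric e -> irreflexive e -> symmetric f ->
    (forall x y z, e x y -> e y z -> ~~ e x z) ->
    (forall x y z, y != x -> z != x -> e y z -> ~~ e x y -> ~~ e x z ->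
       f x z = ~~ f x y) ->
  odd_walk_free e.
Proof.
move=> e_sym e_irr f_sym tri alt m; elim/ltn_ind: m => m IHm z walk_z last_z.
apply/negP => odd_m.
(* The walk is made periodic, so that it may start at any index. *)
pose L := m.+1; pose x k := z (k %% L).
have xL k : x (k + L) = x k by rewrite /x modnDr.
have ex k : e (x k) (x k.+1).
  rewrite /x -[k.+1]addn1 -modnDml.
  have := ltn_pmod k (ltn0Sn m); rewrite -/L ltnS leq_eqVlt => /predU1P[->|lt_m].
    by rewrite addn1 modnn.
  by rewrite addn1 [_.+1 %% L]modn_small ?ltnS // walk_z.
have chordless i d : 2 <= d -> d <= L - 2 ->
    (x (i + d) != x i) /\ ~~ e (x i) (x (i + d)).
  move=> d2 dL; split.
    (* A repeated vertex splits the walk into closed walks of lengths [d] and [L - d], one of them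
       odd. *)
    apply/eqP => xid.
    have := IHm d.-1 _ (fun k => x (i + k)).
    have := IHm (L - d).-1 _ (fun k => x (i + d + k)).
    have -> : i + d + (L - d).-1 = (i + L).-1 by lia.
    have e1 : e (x (i + L).-1) (x i).
      have := ex (i + L).-1; rewrite prednK ?xL //; lia.
    have e2 : e (x (i + d.-1)) (x i).
      by have := ex (i + d.-1); rewrite -addnS prednK ?xid //; lia.
    rewrite !addn0 xid e1 e2 => H1 H2.
    have := H1 _ _ isT; have := H2 _ _ isT.
    move=> {}H2 {}H1.
    have {H2}: ~~ odd d.-1.+1 by apply: H2 => [|k _]; rewrite ?addnS //; lia.
    have {H1}: ~~ odd (L - d).-1.+1 by apply: H1 => [|k _]; rewrite ?addnS //; lia.
    move: odd_m; rewrite /L in dL *; lia.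
  (* A chord yields closed walks of lengths [d + 1] and [L - d + 1], both below [L] and with odd sum
     [L + 2]. *)
  apply/negP => exid.
  have H1 : ~~ odd d.+1.
    apply: (IHm d _ (fun k => x (i + k))) => [|k _|]; rewrite ?addnS ?addn0 //.
      by rewrite /L in dL; lia.
    by rewrite e_sym.
  have H2 : ~~ odd (L - d).+1.
    apply: (IHm (L - d) _ (fun k => x (i + d + k))) => [|k _|];
      rewrite ?addnS ?addn0 //.
      by rewrite /L in dL *; lia.
    by rewrite -addnA subnKC ?xL //; lia.
  by move: odd_m H1 H2; rewrite /L in dL *; lia.
have L4 : 4 <= L.
  case: (ltnP 3 L) => // L3; have [m0|m2] : m = 0 \/ m = 2 by lia.
    by move: last_z; rewrite m0 e_irr.
  rewrite m2 in walk_z last_z.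
  by have := tri _ _ _ (walk_z 0 isT) (walk_z 1 isT); rewrite e_sym last_z.
have alternate i d : d <= L - 4 ->
    f (x i) (x (i + d.+2)) = odd d (+) f (x i) (x (i + 2)).
  elim: d => [|d IHd] dL; first by [].
  have [n1 r1] := chordless i d.+2 isT ltac:(lia).
  have [n2 r2] := chordless i d.+3 isT ltac:(lia).
  have exd : e (x (i + d.+2)) (x (i + d.+3)) by rewrite [i + d.+3]addnS.
  rewrite (alt _ _ _ n1 n2 exd r1 r2) IHd /=; last lia.
  by rewrite addNb.
pose g i := f (x i) (x (i + 2)).
(* By periodicity and symmetry of [f], the pair [x i], [x (i + (L - 2))] is the one that [g] tests
   at [i + (L - 2)]; alternation reaches it after the odd number [L - 4] of flips. *)
have g_shift i : g (i + (L - 2)) = ~~ g i.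
  have := alternate i (L - 4) (leqnn _).
  have -> : (L - 4).+2 = L - 2 by lia.
  have -> : odd (L - 4) by rewrite oddB // odd_m.
  rewrite addTb -/(g i) => <-; rewrite /g f_sym -addnA subnK ?xL //; lia.
have g_iter k : g (k * (L - 2)) = odd k (+) g 0.
  by elim: k => // k IHk; rewrite mulSn addnC g_shift IHk /= addNb.
have xmul k i : x (L * k + i) = x i by rewrite /x mulnC modnMDl.
(* After [L] shifts the index is a multiple of [L], so [g] is back at [g 0], yet it was negated an
   odd number of times. *)
have := g_iter L; rewrite odd_m /g xmul -[X in f (x X) _]addn0 xmul.
by case: (f _ _).
Qed.

(** * Colors of pairs and triangles *)

(* The value blue on the diagonal x = y is junk. *)
Definition pair_color n (c : coloring n) (x y : 'I_n) : color :=
  if insub [set x; y] is Some e then c e else blue.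

Lemma pair_colorC n (c : coloring n) x y : pair_color c x y = pair_color c y x.
Proof. by rewrite /pair_color setUC. Qed.

Lemma pair_colorE n (c : coloring n) x y (e : edge n) :
  val e = [set x; y] -> c e = pair_color c x y.
Proof. by move=> eE; rewrite /pair_color -eE valK. Qed.

Lemma edgeP n (x y : 'I_n) : x != y -> exists e : edge n, val e = [set x; y].
Proof.
move=> xy; have xy2 : #|[set x; y]| == 2 by rewrite cards2 xy.
by exists (Sub [set x; y] xy2); rewrite SubK.
Qed.

Lemma induced_colorsP n (c : coloring n) (S : {set 'I_n}) a :
  reflect (exists x y, [/\ x \in S, y \in S, x != y & pair_color c x y = a])
          (a \in induced_colors c S).
Proof.
apply: (iffP imageP) => [[e eS ->]|[x [y [xS yS xy <-]]]].
  have /cards2P[x [y [xy eE]]] := valP e.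
  move: eS; rewrite inE eE subUset !sub1set => /andP[xS yS].
  by exists x, y; split; rewrite ?(pair_colorE c eE).
have [e eE] := edgeP xy; exists e; last by rewrite (pair_colorE c eE).
by rewrite inE eE subUset !sub1set xS.
Qed.

Lemma induced_colors3 n (c : coloring n) (x y z : 'I_n) :
    x != y -> y != z -> x != z ->
  perm_eq (induced_colors c [set x; y; z])
          [:: pair_color c x y; pair_color c y z; pair_color c x z].
Proof.
move=> xy yz xz.
have [e1 e1E] := edgeP xy; have [e2 e2E] := edgeP yz; have [e3 e3E] := edgeP xz.
rewrite -(pair_colorE c e1E) -(pair_colorE c e2E) -(pair_colorE c e3E).
(* Multiplicities of colors matter, so the lists of edges are compared, where no entry repeats. *)
rewrite -[[:: c e1; _; _]]/(map c [:: e1; e2; e3]); apply: perm_map.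
apply: uniq_perm; rewrite ?enum_uniq //.
  have neq (u v : edge n) t : t \in val u -> t \notin val v -> u != v.
    by move=> tu tv; apply: contraNneq tv => <-.
  rewrite /= !inE negb_or andbT.
  rewrite (@neq e1 e2 x) ?(@neq e1 e3 y) ?(@neq e2 e3 y) ?e1E ?e2E ?e3E ?inE
          ?eqxx ?orbT ?negb_or ?xy ?xz ?yz // eq_sym xy //.
have eqE (u v : edge n) : (u == v) = (val u == val v) by [].
move=> e; rewrite mem_enum !inE !eqE e1E e2E e3E; apply/idP/idP.
  have /cards2P[u [v [uv ->]]] := valP e.
  rewrite subUset !sub1set !inE => /andP[].
  case/orP=> [/orP[]|] /eqP uE; case/orP=> [/orP[]|] /eqP vE;
    move: uv; rewrite uE vE ?eqxx // => _; rewrite ?eqxx ?orbT //;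
    by rewrite setUC eqxx ?orbT.
by case/or3P=> /eqP->; rewrite subUset !sub1set !inE !eqxx ?orbT.
Qed.

Lemma ForbP n (H : seq pattern) (c : coloring n) :
  reflect (forall x y z : 'I_n, x != y -> y != z -> x != z ->
     ~~ has (perm_eq [:: pair_color c x y; pair_color c y z; pair_color c x z])
            H)
   (c \in Forb n H).
Proof.
rewrite inE; apply: (iffP forallP) => [Hc x y z xy yz xz|Hc S].
  have := Hc [set x; y; z].
  have -> : #|[set x; y; z]| == 3.
    by rewrite setUC cardsU1 cards2 !inE negb_or xy ![z == _]eq_sym yz xz.
  by under eq_has => p do rewrite (permPl (induced_colors3 c xy yz xz)).
apply/implyP => S3.
have /card_gt2P[x [y [z [[xS yS zS] [xy yz]]]]] : 2 < #|S| by rewrite (eqP S3).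
rewrite eq_sym => xz.
have -> : S = [set x; y; z].
  apply/esym/eqP; rewrite eqEcard (eqP S3) !subUset !sub1set xS yS zS /=.
  by rewrite setUC cardsU1 cards2 !inE negb_or xy ![z == _]eq_sym yz xz.
under eq_has => p do rewrite (permPl (induced_colors3 c xy yz xz)).
exact: Hc.
Qed.

Lemma color_eqE :
  ((red == blue) = false) * ((red == yellow) = false) *
  ((blue == red) = false) * ((blue == yellow) = false) *
  ((yellow == red) = false) * ((yellow == blue) = false).
Proof. by do !split; apply/eqP. Qed.

Lemma perm_eq_rrr_bbr_yyr (a b d : color) :
  has (perm_eq [:: a; b; d]) patterns_rrr_bbr_yyr =
  [|| [&& a == red, b == red & d == red],
      [&& a == red, b == d & b != red],
      [&& b == red, a == d & a != red] |
      [&& d == red, a == b & a != red]].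
Proof.
by case: a; case: b; case: d;
   rewrite /= /perm_eq /= ?eqxx ?color_eqE.
Qed.

(** * Lower bound *)

Lemma Forb_red_bipartite n (c : coloring n) :
    c \in Forb n patterns_rrr_bbr_yyr ->
  exists s : 'I_n -> bool,
    forall x y, x != y -> pair_color c x y = red -> s x != s y.
Proof.
move/ForbP => Hc.
pose e x y := (x != y) && (pair_color c x y == red).
have e_sym : symmetric e by move=> x y; rewrite /e eq_sym pair_colorC.
have e_irr : irreflexive e by move=> x; rewrite /e eqxx.
pose f x y := pair_color c x y == blue.
have f_sym : symmetric f by move=> x y; rewrite /f pair_colorC.
have [s sP] : exists s : 'I_n -> bool, forall x y, e x y -> s x != s y.
  apply: odd_walk_free_bipartite => //; apply: (no_odd_walk e_sym e_irr f_sym).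
    move=> x y z /andP[xy xyr] /andP[yz yzr]; apply/negP => /andP[xz xzr].
    by have := Hc _ _ _ xy yz xz; rewrite perm_eq_rrr_bbr_yyr xyr yzr xzr.
  move=> x y z yx zx /andP[yz yzr]; rewrite /e /f ![x == _]eq_sym yx zx /=.
  have := Hc y x z yx _ yz; rewrite eq_sym zx => /(_ isT).
  rewrite perm_eq_rrr_bbr_yyr (eqP yzr) (pair_colorC c y x).
  by case: (pair_color c x y); case: (pair_color c x z);
     rewrite ?eqxx ?color_eqE.
by exists s => x y xy xyr; apply: sP; rewrite /e xy xyr eqxx.
Qed.

(** There are exactly three colors, so a set of colors has at most two elements precisely when it is
    not full. *)
Lemma at_most_two_coloredP n (c : coloring n) (S : {set 'I_n}) :
  reflect (exists a, a \notin induced_colors c S) (at_most_two_colored c S).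
Proof.
rewrite /at_most_two_colored.
set C := [set a in induced_colors c S].
have -> : (#|C| <= 2) = (C != setT).
  have card3 : #|{: color}| = 3.
    rewrite -[3]card_ord; apply: (bij_eq_card (f := ord_of_color)).
    exists color_of_ord; first exact: ord_of_colorK.
    by case=> -[|[|[|//]]] i3; apply: val_inj; rewrite /= inordK.
  have := max_card C; rewrite card3 leq_eqVlt ltnS => C3.
  have := eqEcard C setT; rewrite subsetT cardsT card3 /= => ->; lia.
apply: (iffP idP) => [|[a aS]].
  by rewrite -subTset => /subsetPn[a _]; rewrite inE; exists a.
by rewrite -subTset; apply/subsetPn; exists a; rewrite inE.
Qed.

Lemma uphalf_le_h2 n (c : coloring n) :
  c \in Forb n patterns_rrr_bbr_yyr -> uphalf n <= h2 c.
Proof.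
case/Forb_red_bipartite => s sP.
have side b : #|[set x | s x == b]| <= h2 c.
  rewrite /h2; apply: (leq_bigmax_cond (P := at_most_two_colored c)).
  apply/at_most_two_coloredP; exists red.
  apply/negP => /induced_colorsP[x [y [xS yS xy xyr]]].
  by have := sP _ _ xy xyr; move: xS yS; rewrite !inE => /eqP-> /eqP->; rewrite eqxx.
have := cardsC [set x | s x == true]; rewrite card_ord.
have -> : ~: [set x | s x == true] = [set x | s x == false].
  by apply/setP => x; rewrite !inE; case: (s x).
have := side true; have := side false; lia.
Qed.

(** * Upper bound *)

(* The parts are the even and the odd vertices; {2k, 2k+1} are the red pairs. *)
Definition extremal_coloring n : coloring n :=
  [ffun e : edge n =>
    if [forall x in val e, forall y in val e, odd x == odd y] then blue
    else if [forall x in val e, forall y in val e, x./2 == y./2] then red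
    else yellow].

Lemma extremal_colorE n (x y : 'I_n) : x != y ->
  pair_color (extremal_coloring n) x y =
    if odd x == odd y then blue
    else if x./2 == y./2 then red else yellow.
Proof.
move=> xy; have [e eE] := edgeP xy; rewrite -(pair_colorE _ eE) ffunE eE.
have allE (T : eqType) (g : 'I_n -> T) :
    [forall u in [set x; y], forall v in [set x; y], g u == g v] = (g x == g y).
  apply/'forall_in_'forall_in_eqP/eqP => [H|gxy u].
    by apply: H; rewrite !inE eqxx ?orbT.
  by rewrite !inE => /orP[] /eqP-> v; rewrite !inE => /orP[] /eqP->.
by rewrite !allE.
Qed.

(** Blue joins vertices of equal parity, so every triangle has one or three blue edges, while each
    forbidden pattern has none or two. *)
Lemma extremal_coloring_Forb n :
  extremal_coloring n \in Forb n patterns_rrr_bbr_yyr.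
Proof.
apply/ForbP => x y z xy yz xz; rewrite perm_eq_rrr_bbr_yyr !extremal_colorE //.
case: (odd x); case: (odd y); case: (odd z) => /=;
  case: (x./2 == y./2); case: (y./2 == z./2); case: (x./2 == z./2) => /=;
  by rewrite ?eqxx ?color_eqE.
Qed.

Lemma leq_card_inj_ord n k (S : {set 'I_n}) (g : nat -> nat) :
    (forall x, x \in S -> g x < k) ->
    {in S &, forall x y : 'I_n, x < y -> g x <> g y} -> #|S| <= k.
Proof.
move=> gk g_inj; case: (set_0Vmem S) => [->|[x0 x0S]]; first by rewrite cards0.
case: k gk => [/(_ _ x0S)//|k] gk.
rewrite -[k.+1]card_ord.
apply: (@leq_card_in _ _ (fun x : 'I_n => inord (g x) : 'I_k.+1)) => x y xS yS.
move/(congr1 val); rewrite /= !inordK ?gk // => gxy; apply: val_inj => /=.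
by case: (ltngtP x y) => // [/(g_inj _ _ xS yS)|/(g_inj _ _ yS xS)]; case.
Qed.

Lemma h2_extremal n : n <> 2 -> h2 (extremal_coloring n) <= uphalf n.
Proof.
move=> n2; case: (leqP n 1) => [n1|n_gt1].
  by apply: leq_trans (h2_le _) _; case: n n1 {n2} => [|[]].
apply/bigmax_leqP => S /at_most_two_coloredP[a aS].
have avoid (x y : 'I_n) : x \in S -> y \in S -> x < y ->
    (if odd x == odd y then blue else if x./2 == y./2 then red else yellow) <> a.
  move=> xS yS xy ca; apply/negP: aS; rewrite negbK; apply/induced_colorsP.
  have x_neq_y : x != y by rewrite neq_ltn xy.
  by exists x, y; rewrite extremal_colorE.
case: a {aS} avoid => avoid.
(* No red: two vertices with the same half would form a red pair. *)
- apply: (@leq_card_inj_ord _ _ _ half) => [x _|x y xS yS xy hxy].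
    have := ltn_ord x; lia.
  apply: (avoid _ _ xS yS xy); rewrite hxy eqxx ifN //; lia.
(* No blue: at most one vertex of each parity, and [2 <= uphalf n] because [n >= 3]. *)
- apply: (@leq_trans 2); last lia.
  apply: (@leq_card_inj_ord _ _ _ (fun i => odd i)) => [x _|x y xS yS xy hxy].
    by case: odd.
  apply: (avoid _ _ xS yS xy); by rewrite ifT //; lia.
- (* The yellow pairs are {2k-1, 2k}, closed up cyclically by {n-1, 0} when
     n is even. *)
  pose g i := if i == (uphalf n).*2.-1 then 0 else uphalf i.
  apply: (@leq_card_inj_ord _ _ _ g) => [x _|x y xS yS xy].
    have := ltn_ord x; rewrite /g; case: ifP; lia.
  rewrite /g => hxy; apply: (avoid _ _ xS yS xy).
  (* For odd [n] the exceptional index of [g] is [n], which is no vertex. For even [n] it is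
     [n - 1], and [n >= 4] gives 0 and [n - 1] different halves, so this pair is yellow. *)
  have := ltn_ord y.
  by rewrite ifN ?ifN //; move: hxy xy; case: ifP; case: ifP; lia.
Qed.

(* uphalf n is the ceiling of n / 2. The case n = 2 is excluded because the
   single edge of K_2 uses one color, so that h_2 is 2 there and not 1. *)
Theorem lemma3p21 (n : nat) (n_neq2 : n <> 2) :
  h2_min n patterns_rrr_bbr_yyr = uphalf n.
Proof.
have exF := extremal_coloring_Forb n.
have /h2_minP[[c cF <-] h2_min_le] : Forb n patterns_rrr_bbr_yyr != set0.
  by apply/set0Pn; exists (extremal_coloring n).
apply/eqP; rewrite eqn_leq uphalf_le_h2 // andbT.
exact: leq_trans (h2_min_le _ exF) (h2_extremal n_neq2).
Qed.
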